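(* Let $R$ be a commutative ring. Then $R$ is weakly tripotent if and only if $R$ has a direct product decomposition $R = R'\times R''$ such that: (1) $R''$ is a tripotent ring of characteristic $3$ or $R''=0$; (2) $R'=0$, or $R'$ can be embedded as a subring of a direct product $R_0\times\left(\prod_{i\in I}R_i\right)$ such that $R_0$ is a weakly tripotent ring without nontrivial idempotents, and all the rings $R_i$ ($i\in I$) are Boolean rings.
   Context: Rings are associative with identity, and subrings contain the identity of the larger ring. An element $x$ of a ring is tripotent if $x^3=x$; a ring is tripotent if all its elements are tripotent. A ring $R$ is weakly tripotent if for every $x\in R$ at least one of the elements $x$ or $1+x$ is tripotent. A ring is without nontrivial idempotents if its only idempotents are $0$ and $1$. A ring is Boolean if $x^2=x$ for all its elements $x$. *)

(* Defs.v *)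
From HB Require Import structures.
From mathcomp Require Import all_boot all_algebra.
From mathcomp Require Import boolp.

Set Implicit Arguments.
Unset Strict Implicit.
Unset Printing Implicit Defensive.

Import GRing.Theory.
Local Open Scope ring_scope.

(* Rings are taken in pzRingType / comPzRingType, so that the zero ring is
   allowed; {rmorphism _ -> _} preserves 1. *)

Definition tripotent (R : pzRingType) (x : R) : Prop := x ^+ 3 = x.

Definition tripotent_ring (R : pzRingType) : Prop := forall x : R, tripotent x.

Definition weakly_tripotent_ring (R : pzRingType) : Prop :=
  forall x : R, tripotent x \/ tripotent (1 + x).

Definition idempotent (R : pzRingType) (x : R) : Prop := x ^+ 2 = x.

Definition no_nontrivial_idempotents (R : pzRingType) : Prop :=
  forall x : R, idempotent x -> x = 0 \/ x = 1.

Definition boolean_ring (R : pzRingType) : Prop := forall x : R, x ^+ 2 = x.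

Definition zero_ring (R : pzRingType) : Prop := forall x : R, x = 0.

(* n generates the kernel of the map from the integers to R; the library's
   [pchar R] is only available for nonzero rings. *)
Definition has_characteristic (R : pzRingType) (n : nat) : Prop :=
  forall m : nat, m%:R = 0 :> R <-> (n %| m)%N.

Definition ring_prod (I : Type) (R_ : I -> pzRingType) : Type :=
  forall i : I, R_ i.

Section RingProd.
Variables (I : Type) (R_ : I -> pzRingType).
Local Notation P := (ring_prod R_).
Implicit Types f g h : P.

HB.instance Definition _ := gen_eqMixin P.
HB.instance Definition _ := gen_choiceMixin P.

Definition ring_prod_zero : P := fun=> 0.
Definition ring_prod_one : P := fun=> 1.
Definition ring_prod_opp f : P := fun i => - f i.
Definition ring_prod_add f g : P := fun i => f i + g i.
Definition ring_prod_mul f g : P := fun i => f i * g i.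

Fact ring_prod_addA : associative ring_prod_add.
Proof. by move=> f g h; apply: functional_extensionality_dep => i; exact: addrA. Qed.
Fact ring_prod_addC : commutative ring_prod_add.
Proof. by move=> f g; apply: functional_extensionality_dep => i; exact: addrC. Qed.
Fact ring_prod_add0 : left_id ring_prod_zero ring_prod_add.
Proof. by move=> f; apply: functional_extensionality_dep => i; exact: add0r. Qed.
Fact ring_prod_addN : left_inverse ring_prod_zero ring_prod_opp ring_prod_add.
Proof. by move=> f; apply: functional_extensionality_dep => i; exact: addNr. Qed.

HB.instance Definition _ := GRing.isZmodule.Build P
  ring_prod_addA ring_prod_addC ring_prod_add0 ring_prod_addN.

Fact ring_prod_mulA : associative ring_prod_mul.
Proof. by move=> f g h; apply: functional_extensionality_dep => i; exact: mulrA. Qed.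
Fact ring_prod_mul1l : left_id ring_prod_one ring_prod_mul.
Proof. by move=> f; apply: functional_extensionality_dep => i; exact: mul1r. Qed.
Fact ring_prod_mul1r : right_id ring_prod_one ring_prod_mul.
Proof. by move=> f; apply: functional_extensionality_dep => i; exact: mulr1. Qed.
Fact ring_prod_mulDl : left_distributive ring_prod_mul +%R.
Proof. by move=> f g h; apply: functional_extensionality_dep => i; exact: mulrDl. Qed.
Fact ring_prod_mulDr : right_distributive ring_prod_mul +%R.
Proof. by move=> f g h; apply: functional_extensionality_dep => i; exact: mulrDr. Qed.

HB.instance Definition _ := GRing.Zmodule_isPzRing.Build P
  ring_prod_mulA ring_prod_mul1l ring_prod_mul1r ring_prod_mulDl ring_prod_mulDr.

End RingProd.

Definition embeds_as_subring (R S : pzRingType) : Prop :=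
  exists f : {rmorphism R -> S}, injective f.

Definition ring_isomorphic (R S : pzRingType) : Prop :=
  exists f : {rmorphism R -> S}, bijective f.

(* Main.v *)
(** In a weakly tripotent ring 24 = 0, so R = R/(8) x R/(3), and cubing is
    additive when 3 = 0, so R/(3) is tripotent.  Now let 8 = 0 and let J be the
    ideal of the x such that every multiple of x is idempotent.  If e is an
    idempotent, testing weak tripotency on e x + (1 - e)(y - 1) shows that all
    elements of e R or all elements of (1 - e) R are tripotent, that is, e or
    1 - e is in J.  Since idempotents lift modulo J, R / J has no nontrivial
    idempotents.  Each R / ann(x) with x in J is Boolean, and the map from R to
    the product of R / J and these rings is injective because x in J and
    x * x = 0 imply x = x ^ 2 = 0. *)

From HB Require Import structures.
From mathcomp Require Import all_boot all_algebra ring_quotient.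
From mathcomp Require Import boolp.
From mathcomp Require Import ring.
Require Import Defs.

Set Implicit Arguments.
Unset Strict Implicit.
Unset Printing Implicit Defensive.

Import GRing.Theory.
Local Open Scope ring_scope.
Local Open Scope quotient_scope.

(** * Quotients of commutative rings, and the ideal of elements with only idempotent multiples *)

Section Ideals.
Variable R : comPzRingType.
Implicit Types (J : R -> Prop) (x y : R).

Definition is_ideal J : Prop :=
  [/\ J 0, forall x y, J x -> J y -> J (x + y) & forall a x, J x -> J (a * x)].

(** The product is defined through representatives on the additive quotient, so [J] may be all of
    [R], with the zero ring as quotient. The result is a sigma type so that projections yield a
    whole family of quotients at once. *)
Lemma quotient_ring J : is_ideal J ->
  {S : comPzRingType & {p : {rmorphism R -> S} |
    (forall s : S, exists x, s = p x) /\ (forall x, p x = 0 <-> J x)}}.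
Proof.
case=> J0 JD JM.
pose Jb : R -> bool := fun x => `[<J x>].
have Jb_closed : zmod_closed Jb.
  split=> [|x y /asboolP Jx /asboolP Jy]; apply/asboolP => //.
  by apply: JD => //; rewrite -mulN1r; apply: JM.
pose I : zmodClosed R := HB.pack_for (zmodClosed R) Jb
  (GRing.isZmodClosed.Build R Jb Jb_closed).
pose Q := Quotient.quot I.
pose oneq : Q := \pi_Q 1.
pose mulq (u v : Q) : Q := \pi_Q (repr u * repr v).
have pi_eq (x y : R) : x - y \in Jb -> \pi_Q x = \pi_Q y.
  by move=> h; apply/eqP; rewrite -Quotient.idealrBE.
have pi_repr (x : R) : x - repr (\pi_Q x) \in Jb.
  by have := Quotient.idealrBE I x (repr (\pi_Q x)); rewrite reprK eqxx.
have pi_mulq x y : mulq (\pi_Q x) (\pi_Q y) = \pi_Q (x * y).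
  apply/esym/pi_eq.
  have -> : x * y - repr (\pi_Q x) * repr (\pi_Q y) =
    y * (x - repr (\pi_Q x)) + repr (\pi_Q x) * (y - repr (\pi_Q y)) by ring.
  by apply/asboolP/JD; apply: JM; apply/asboolP/pi_repr.
have piP (u : Q) : exists x, u = \pi_Q x by exists (repr u); rewrite reprK.
have mulqA : associative mulq.
  move=> u v w; have [[x ->] [y ->] [z ->]] := And3 (piP u) (piP v) (piP w).
  by rewrite !pi_mulq mulrA.
have mulqC : commutative mulq by move=> u v; rewrite /mulq mulrC.
have mul1q : left_id oneq mulq.
  by move=> u; have [x ->] := piP u; rewrite pi_mulq mul1r.
have mulqDl : left_distributive mulq +%R.
  move=> u v w; have [[x ->] [y ->] [z ->]] := And3 (piP u) (piP v) (piP w).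
  by rewrite -raddfD !pi_mulq -raddfD /= mulrDl.
pose S : comPzRingType := HB.pack_for comPzRingType Q
  (GRing.Zmodule_isComPzRing.Build Q mulqA mulqC mul1q mulqDl).
pose f : R -> S := \pi_Q.
have f_add : zmod_morphism f by move=> x y; exact: (raddfB (\pi_Q)).
have f_mul : monoid_morphism f by split=> // x y; exact/esym/pi_mulq.
pose p : {rmorphism R -> S} := HB.pack_for {rmorphism R -> S} f
  (GRing.isZmodMorphism.Build R S f f_add)
  (GRing.isMonoidMorphism.Build R S f f_mul).
exists S, p; split=> [|x]; first exact: piP.
have -> : (p x = 0) = (\pi_Q x = \pi_Q 0) by rewrite (raddf0 (\pi_Q)).
split=> [/eqP|Jx]; first by rewrite -Quotient.idealrBE subr0 => /asboolP.
by apply: pi_eq; rewrite subr0; apply/asboolP.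
Qed.

Lemma principal_ideal a : is_ideal (fun x => exists b, x = a * b).
Proof.
split; first by exists 0; rewrite mulr0.
  by move=> _ _ [b ->] [c ->]; exists (b + c); rewrite mulrDr.
by move=> c _ [b ->]; exists (c * b); rewrite mulrCA.
Qed.

Lemma annihilator_ideal a : is_ideal (fun x => a * x = 0).
Proof.
split; first exact: mulr0.
  by move=> x y ax0 ay0; rewrite mulrDr ax0 ay0 addr0.
by move=> c x ax0; rewrite mulrCA ax0 mulr0.
Qed.

Definition boolean_ideal x : Prop := forall y, idempotent (x * y).

Lemma boolean_ideal_idempotent x : boolean_ideal x -> x * x = x.
Proof. by move=> /(_ 1); rewrite /idempotent mulr1 expr2. Qed.

Lemma boolean_idealM a x : boolean_ideal x -> boolean_ideal (a * x).
Proof. by move=> Jx y; rewrite (mulrC a) -mulrA; apply: Jx. Qed.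

(** Both [x] and [- x] are idempotent, and they have the same square. *)
Lemma boolean_ideal_mul2n x : boolean_ideal x -> x *+ 2 = 0.
Proof.
move=> Jx; have := boolean_ideal_idempotent (boolean_idealM (-1) Jx).
rewrite mulN1r mulrNN boolean_ideal_idempotent // => xN.
by rewrite mulr2n {2}xN subrr.
Qed.

Lemma boolean_ideal_is_ideal : is_ideal boolean_ideal.
Proof.
split=> [y|x y Jx Jy z|a x]; last exact: boolean_idealM.
  by rewrite /idempotent mul0r expr0n.
(* The cross term of [((x + y) * z) ^+ 2] is twice a multiple of [x], hence zero. *)
have Jxy := boolean_ideal_mul2n (boolean_idealM (z * z * y) Jx).
rewrite /idempotent mulrDl sqrrD Jx Jy.
have -> : x * z * (y * z) = z * z * y * x by ring.
by rewrite Jxy addr0.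
Qed.

End Ideals.

(** * Transfer of weak tripotency, and characteristic 3 *)

Lemma weakly_tripotent_surj (R S : pzRingType) (p : {rmorphism R -> S}) :
  (forall y, exists x, y = p x) ->
  weakly_tripotent_ring R -> weakly_tripotent_ring S.
Proof.
move=> p_surj wR y; have [x ->] := p_surj y.
rewrite /tripotent -(rmorph1 p) -rmorphD -!rmorphXn /=.
by case: (wR x) => ->; [left|right].
Qed.

Lemma weakly_tripotent_inj (R S : pzRingType) (p : {rmorphism R -> S}) :
  injective p -> weakly_tripotent_ring S -> weakly_tripotent_ring R.
Proof.
move=> p_inj wS x; case: (wS (p x)) => tx; [left|right]; apply: p_inj;
  by rewrite rmorphXn ?rmorphD ?rmorph1.
Qed.

(** With [S] tripotent, the choice between an element and its shift by 1 is dictated by [R] alone.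
    Two weakly tripotent factors would not do: in Z/4 x Z/4 the element (2, 1) and its shift (3, 2)
    both fail. *)
Lemma weakly_tripotent_prod (R S : pzRingType) :
  weakly_tripotent_ring R -> tripotent_ring S ->
  weakly_tripotent_ring (R * S)%type.
Proof.
move=> wR tS [x y].
have pairX3 (u : R) (v : S) : ((u, v) : (R * S)%type) ^+ 3 = (u ^+ 3, v ^+ 3).
  by rewrite !exprS !expr0.
case: (wR x) => tx; [left|right]; rewrite /tripotent.
  by rewrite pairX3 tx tS.
have -> : 1 + ((x, y) : (R * S)%type) = (1 + x, 1 + y) by [].
by rewrite pairX3 tx tS.
Qed.

Lemma boolean_tripotent (R : pzRingType) :
  boolean_ring R -> tripotent_ring R.
Proof. by move=> bR x; rewrite /tripotent exprS bR -expr2 bR. Qed.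

Lemma tripotent_ring_prod (I : Type) (R_ : I -> pzRingType) :
  (forall i, tripotent_ring (R_ i)) -> tripotent_ring (ring_prod R_).
Proof.
move=> tR f; rewrite /tripotent !exprS expr0 mulr1.
apply: functional_extensionality_dep => i.
by have := tR i (f i); rewrite /tripotent !exprS expr0 mulr1.
Qed.

(** Test the element 2: either 2^3 - 2 = 6 or 3^3 - 3 = 24 vanishes. *)
Lemma weakly_tripotent_24 (R : pzRingType) :
  weakly_tripotent_ring R -> 24%:R = 0 :> R.
Proof.
case/(_ 2%:R); rewrite /tripotent -?natrX ?nat1r -?natrX => /eqP.
  by rewrite -subr_eq0 -natrB // => /eqP h; rewrite (natrM _ 6 4) h mul0r.
by rewrite -subr_eq0 -natrB // => /eqP.
Qed.

Lemma tripotent_char3 (R : comPzRingType) :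
  weakly_tripotent_ring R -> 3%:R = 0 :> R -> tripotent_ring R.
Proof.
move=> wR R3 x; case: (wR x) => // tx; rewrite /tripotent.
have -> : x ^+ 3 = (1 + x) ^+ 3 - 1 - 3%:R * (x + x ^+ 2) by ring.
by rewrite tx R3; ring.
Qed.

Lemma has_characteristic3 (R : pzRingType) :
  3%:R = 0 :> R -> ~ zero_ring R -> has_characteristic R 3.
Proof.
move=> R3 Rn0 m.
have one_neq0 : 1 <> 0 :> R.
  by move=> R1; apply: Rn0 => x; rewrite -[x]mulr1 R1 mulr0.
have {1}-> : m%:R = (m %% 3)%:R :> R.
  by rewrite {1}(divn_eq m 3) natrD natrM R3 mulr0 add0r.
rewrite /dvdn; case: (m %% 3)%N (ltn_pmod m (isT : 0 < 3)%N) => [|[|[|]]] // _.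
split=> // R2; case: one_neq0.
by move: R3; rewrite -natr1 R2 add0r.
Qed.

(** * Rings with 8 = 0 *)

Section CharacteristicEight.
Variable R : comPzRingType.
Hypothesis R8 : 8%:R = 0 :> R.

Lemma tripotent_multiples_boolean_ideal (e : R) : idempotent e ->
  (forall x, tripotent (e * x)) -> boolean_ideal e.
Proof.
move=> ee te x; rewrite /idempotent.
have e3 : e ^+ 3 = e by rewrite exprS ee -expr2 ee.
have teX y : e * y ^+ 3 = e * y by rewrite -{1}e3 -exprMn te.
(* Tripotency of [e * 2] gives 8e = 2e, and 8 = 0. *)
have e2 : e * 2%:R = 0.
  have -> : e * 2%:R = e * 8%:R - (e * 2%:R ^+ 3 - e * 2%:R) by ring.
  by rewrite teX R8; ring.
rewrite exprMn ee.
(* Subtracting the cubic relation at [x] from the one at [1 + x] leaves 3e(x^2 + x) = 0, which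
   modulo 2e reads e x^2 = e x. *)
have -> : e * x ^+ 2 = e * x + (e * (1 + x) ^+ 3 - e * (1 + x))
  - (e * x ^+ 3 - e * x) - e * 2%:R * (x ^+ 2 + 2%:R * x) by ring.
by rewrite !teX e2; ring.
Qed.

Hypothesis wR : weakly_tripotent_ring R.

Lemma idempotent_boolean_ideal (e : R) : idempotent e ->
  boolean_ideal e \/ boolean_ideal (1 - e).
Proof.
move=> ee.
have ee' : idempotent (1 - e) by rewrite /idempotent sqrrB ee; ring.
have e3 : e ^+ 3 = e by rewrite exprS ee -expr2 ee.
have e3' : (1 - e) ^+ 3 = 1 - e by rewrite exprS ee' -expr2 ee'.
have [te|/existsNP[x ntx]] := pselect (forall x, tripotent (e * x)).
  by left; apply: tripotent_multiples_boolean_ideal.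
right; apply: tripotent_multiples_boolean_ideal => // y.
(* The tested element z has [e]-component [e * x], while [1 + z] has [(1 - e)]-component
   [(1 - e) * y]; this is why [y] is shifted by 1. As [e * x] is not tripotent, z is not, so [1 + z]
   is. *)
have proj1 : e * (e * x + (1 - e) * (y - 1)) = e * x.
  have -> : e * (e * x + (1 - e) * (y - 1)) =
    e * x + (e ^+ 2 - e) * (x - y + 1) by ring.
  by rewrite ee subrr mul0r addr0.
have proj2 : (1 - e) * (1 + (e * x + (1 - e) * (y - 1))) = (1 - e) * y.
  have -> : (1 - e) * (1 + (e * x + (1 - e) * (y - 1))) =
    (1 - e) * y + (e ^+ 2 - e) * (y - 1 - x) by ring.
  by rewrite ee subrr mul0r addr0.
case: (wR (e * x + (1 - e) * (y - 1))) => tz.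
  by case: ntx; rewrite /tripotent -proj1 exprMn e3 tz.
by rewrite /tripotent -proj2 exprMn e3' tz.
Qed.

Lemma quotient_no_nontrivial_idempotents (S : pzRingType)
    (p : {rmorphism R -> S}) : (forall y, exists x, y = p x) ->
  (forall x, p x = 0 <-> boolean_ideal x) -> no_nontrivial_idempotents S.
Proof.
move=> p_surj p_ker s; have [y -> ] := p_surj s => py.
pose d := y ^+ 2 - y.
have Jd : boolean_ideal d by apply/p_ker; rewrite rmorphB rmorphXn py subrr.
have dd := boolean_ideal_idempotent Jd.
(* The defect [d] of the lift [y] is itself idempotent, so the factor [1 - d] kills it; since [d]
   maps to 0, [(1 - d) * y] is still a lift. *)
have ee : idempotent ((1 - d) * y).
  apply/eqP; rewrite /idempotent -subr_eq0; apply/eqP.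
  have -> : ((1 - d) * y) ^+ 2 - (1 - d) * y =
    (1 - d) * d - y ^+ 2 * (d - d * d) by rewrite /d; ring.
  by rewrite mulrBl mul1r dd subrr mulr0 subr0.
have pd : p d = 0 by apply/p_ker.
have pe : p ((1 - d) * y) = p y.
  by rewrite rmorphM rmorphB rmorph1 pd subr0 mul1r.
case: (idempotent_boolean_ideal ee) => /p_ker.
  by rewrite pe => ->; left.
by rewrite rmorphB rmorph1 pe => /subr0_eq ->; right.
Qed.

Lemma weakly_tripotent_embedding :
  exists (R0 : pzRingType) (I : Type) (R_ : I -> pzRingType),
    [/\ embeds_as_subring R (R0 * ring_prod R_)%type,
        weakly_tripotent_ring R0,
        no_nontrivial_idempotents R0 &
        forall i : I, boolean_ring (R_ i)].
Proof.
have [R0 [p0 [p0_surj p0_ker]]] := quotient_ring (boolean_ideal_is_ideal R).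
pose I := {x : R | boolean_ideal x}.
(* The quotient by the annihilator of [i] is a copy of the ideal generated by [i], with the
   idempotent [i] as identity. *)
pose Q (i : I) := quotient_ring (annihilator_ideal (sval i)).
pose R_ (i : I) : pzRingType := projT1 (Q i).
pose p_ i : {rmorphism R -> R_ i} := sval (projT2 (Q i)).
have p_surj i y : exists x, y = p_ i x by exact: (svalP (projT2 (Q i))).1.
have p_ker i x : p_ i x = 0 <-> sval i * x = 0.
  exact: (svalP (projT2 (Q i))).2.
exists R0, I, R_; split.
- pose f (x : R) : (R0 * ring_prod R_)%type := (p0 x, fun i => p_ i x).
  have f_add : zmod_morphism f.
    move=> x y; congr pair; first exact: rmorphB.
    by apply: functional_extensionality_dep => i; exact: rmorphB.
  have f_mul : monoid_morphism f.
    split=> [|x y]; congr pair; [exact: rmorph1| |exact: rmorphM|];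
      apply: functional_extensionality_dep => i; first exact: rmorph1.
    exact: rmorphM.
  pose F : {rmorphism R -> (R0 * ring_prod R_)%type} :=
    HB.pack_for {rmorphism R -> (R0 * ring_prod R_)%type} f
      (GRing.isZmodMorphism.Build _ _ f f_add)
      (GRing.isMonoidMorphism.Build _ _ f f_mul).
  exists F; apply: raddf_inj => x [/p0_ker Jx fx].
  (* Being in the ideal, [x] is itself an index; its own coordinate gives [x * x = 0]. *)
  have : p_ (exist _ x Jx) x = 0.
    exact: (congr1 (fun g : ring_prod R_ => g (exist _ x Jx)) fx).
  by move/p_ker => /=; rewrite boolean_ideal_idempotent.
- exact: weakly_tripotent_surj wR.
- exact: quotient_no_nontrivial_idempotents p0_ker.
- move=> i s; have [x ->] := p_surj i s.
  apply: subr0_eq; rewrite -rmorphXn -rmorphB; apply/p_ker.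
  have Ji : boolean_ideal (sval i) := svalP i.
  by rewrite mulrBr -{1}(boolean_ideal_idempotent Ji) -expr2 -exprMn Ji subrr.
Qed.

End CharacteristicEight.

(** * The decomposition theorem *)

Theorem theorem15 (R : comPzRingType) :
  weakly_tripotent_ring R <->
  exists R' R'' : pzRingType,
    [/\ ring_isomorphic R (R' * R'')%type,
        (tripotent_ring R'' /\ has_characteristic R'' 3) \/ zero_ring R'' &
        zero_ring R' \/
        exists (R0 : pzRingType) (I : Type) (R_ : I -> pzRingType),
          [/\ embeds_as_subring R' (R0 * ring_prod R_)%type,
              weakly_tripotent_ring R0,
              no_nontrivial_idempotents R0 &
              forall i : I, boolean_ring (R_ i)]].
Proof.
split=> [wR|[R' [R'' [[p p_bij] R''P R'P]]]]; last first.
  (* The converse: weak tripotency descends to subrings and survives products with a tripotent ring,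
     here first [R''] and then the product of the Boolean rings. *)
  apply: (weakly_tripotent_inj (bij_inj p_bij)).
  apply: weakly_tripotent_prod; last first.
    by case: R''P => [[]|R''0] // x; rewrite /tripotent [x]R''0 expr0n.
  case: R'P => [R'0 x|[R0 [I [R_ [[q q_inj] wR0 _ bR]]]]].
    by left; rewrite /tripotent [x]R'0 expr0n.
  apply: (weakly_tripotent_inj q_inj); apply: weakly_tripotent_prod => //.
  by apply: tripotent_ring_prod => i; exact: boolean_tripotent.
have R24 := weakly_tripotent_24 wR.
have [R' [p [p_surj p_ker]]] := quotient_ring (principal_ideal (8%:R : R)).
have [R'' [q [q_surj q_ker]]] := quotient_ring (principal_ideal (3%:R : R)).
have R'8 : 8%:R = 0 :> R'.
  by rewrite -(rmorph_nat p); apply/p_ker; exists 1; rewrite mulr1.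
have R''3 : 3%:R = 0 :> R''.
  by rewrite -(rmorph_nat q); apply/q_ker; exists 1; rewrite mulr1.
have wR' := weakly_tripotent_surj p_surj wR.
have wR'' := weakly_tripotent_surj q_surj wR.
exists R', R''; split; last by right; exact: weakly_tripotent_embedding.
- pose f (x : R) : (R' * R'')%type := (p x, q x).
  have f_add : zmod_morphism f by move=> x y; rewrite /f !rmorphB.
  have f_mul : monoid_morphism f.
    by split=> [|x y]; rewrite /f ?rmorph1 ?rmorphM.
  pose F : {rmorphism R -> (R' * R'')%type} :=
    HB.pack_for {rmorphism R -> (R' * R'')%type} f
      (GRing.isZmodMorphism.Build _ _ f f_add)
      (GRing.isMonoidMorphism.Build _ _ f f_mul).
  have F_inj : injective F.
    apply: raddf_inj => x [/p_ker[a xa] /q_ker[b xb]].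
    (* Modulo 24, the integers 9 and -8 are the complementary idempotents of Z/8 x Z/3: 9 is 1 mod 8
       and 0 mod 3, and -8 is 0 mod 8 and 1 mod 3. *)
    have -> : x = 9%:R * x - 8%:R * x by ring.
    rewrite {1}xa xb.
    have -> : 9%:R * (8%:R * a) - 8%:R * (3%:R * b) =
      24%:R * (3%:R * a - b) by ring.
    by rewrite R24 mul0r.
  have F_surj (u : (R' * R'')%type) : exists x, F x = u.
    case: u => u v; have [a ->] := p_surj u; have [b ->] := q_surj v.
    (* The same two idempotents give an element congruent to [a] mod 8 and to [b] mod 3. *)
    exists (9%:R * a - 8%:R * b); congr pair; apply: subr0_eq.
      rewrite -rmorphB; apply/p_ker; exists (a - b); ring.
    rewrite -rmorphB; apply/q_ker; exists (3%:R * (a - b)); ring.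
  have [g Fg] := choice F_surj.
  by exists F; exists g => // x; apply: F_inj; rewrite Fg.
(* The zero ring has characteristic 1, hence the case split. *)
- have [R''0|R''n0] := pselect (zero_ring R''); first by right.
  left; split; first exact: tripotent_char3.
  exact: has_characteristic3.
Qed.
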